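(* Let $G=(X\cup Y,\sigma,\mu)$ be a complete bipartite fuzzy graph, all of whose vertices have positive membership value, with vertex classes $X=\{x_1,\ldots,x_r\}$ and $Y=\{y_1,\ldots,y_s\}$, where $|X|=r\le s=|Y|$, $\mu_s(x_i)\le\mu_s(x_{i+1})$ for $1\le i<r$ and $\mu_s(y_j)\le\mu_s(y_{j+1})$ for $1\le j<s$. The following assertions hold: (i) If $r=1$ then $\gamma_{snR}(G)=2\mu_s(x_1)$. (ii) If $r=s=2$ then $$\gamma_{snR}(G)=\begin{cases}4\mu_s(x_1), & \text{if } 2\mu_s(x_1)\le\min\{\mu_s(x_2),\mu_s(y_2)\},\\ 2\mu_s(x_1)+\min\{\mu_s(x_2),\mu_s(y_2)\}, & \text{if } 2\mu_s(x_1)\ge\max\{\mu_s(x_2),\mu_s(y_2)\}.\end{cases}$$ (iii) If $r=2$ and $s\ge 3$ then $\gamma_{snR}(G)=\min\{4\mu_s(x_1),\,2\mu_s(x_1)+\mu_s(x_2)\}$. (iv) If $r\ge 3$ then $\gamma_{snR}(G)=4\mu_s(x_1)$.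
   Context: A fuzzy graph $G=(V,\sigma,\mu)$ consists of a finite nonempty set $V$, a function $\sigma:V\to[0,1]$, and a symmetric function $\mu:V\times V\to[0,1]$ with $\mu(x,x)=0$ and $\mu(x,y)\le \min\{\sigma(x),\sigma(y)\}$ for all $x,y\in V$. It is complete bipartite with classes $X,Y$ if $V$ is the disjoint union of nonempty sets $X$ and $Y$, $\mu(u,v)=0$ whenever $u,v\in X$ or $u,v\in Y$, and $\mu(u,v)=\min\{\sigma(u),\sigma(v)\}$ for all $u\in X$, $v\in Y$. An edge is an unordered pair $(u,v)$ of distinct vertices with $\mu(u,v)>0$, and $\mu(u,v)$ is its weight. The strength of a path $x_0,x_1,\ldots,x_m$ (with every $\mu(x_{i-1},x_i)>0$) is $\min_i \mu(x_{i-1},x_i)$, and $CONN_G(u,v)$ is the maximum strength of all $u$–$v$ paths. An edge $(u,v)$ is strong if $\mu(u,v)=CONN_G(u,v)$; then $u,v$ are strong neighbors. $N_s(u)$ is the set of strong neighbors of $u$. Put $\mu_s(u)=\min\{\mu(u,v):v\in N_s(u)\}$, with $\mu_s(u)=0$ if $N_s(u)=\emptyset$. A strong-neighbors Roman dominating function (SNRDF) on $G$ is a function $f:V\to\{0,1,2\}$ such that every $u$ with $f(u)=0$ has some $v\in N_s(u)$ with $f(v)=2$. Its weight is $w(f)=\sum_{u\in V}f(u)\mu_s(u)$, and $\gamma_{snR}(G)$ is the minimum weight of an SNRDF on $G$. *)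

(* Defs.v *)
From HB Require Import structures.
From mathcomp Require Import all_boot all_order all_algebra.
From mathcomp Require Import reals.

Set Implicit Arguments.
Unset Strict Implicit.
Unset Printing Implicit Defensive.

Import Order.TTheory GRing.Theory Num.Theory.
Local Open Scope ring_scope.

Record fuzzyGraph (R : realType) (V : finType) := FuzzyGraph {
  sigma : V -> R;
  mu : V -> V -> R;
  fg_nonempty : (0 < #|V|)%N;
  sigma_itv : forall u, 0 <= sigma u <= 1;
  mu_itv : forall u v, 0 <= mu u v <= 1;
  mu_sym : forall u v, mu u v = mu v u;
  mu_irrefl : forall u, mu u u = 0;
  mu_le : forall u v, mu u v <= Num.min (sigma u) (sigma v)
}.

Section FuzzyGraph.
Context (R : realType) (V : finType).
Variable G : fuzzyGraph R V.

Record complete_bipartite (X Y : {set V}) : Prop := CompleteBipartite {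
  cb_cover : X :|: Y = [set: V];
  cb_disjoint : [disjoint X & Y];
  cb_X_neq0 : X != set0;
  cb_Y_neq0 : Y != set0;
  cb_X_indep : forall u v, u \in X -> v \in X -> mu G u v = 0;
  cb_Y_indep : forall u v, u \in Y -> v \in Y -> mu G u v = 0;
  cb_complete : forall u v, u \in X -> v \in Y ->
    mu G u v = Num.min (sigma G u) (sigma G v)
}.

Definition is_edge (u v : V) : bool := (u != v) && (0 < mu G u v).

(* As in [path], the sequence x_0, x_1, ..., x_m is given by its head x_0 = u
   and its tail p = [:: x_1; ...; x_m]. Its vertices are distinct, so that
   m < #|V|. *)
Definition is_path (u v : V) (p : seq V) : bool :=
  [&& path (fun a b => 0 < mu G a b) u p, last u p == v & uniq (u :: p)].

(* All weights are at most 1, so 1 is neutral for the minimum; it is the value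
   only of the path with no edge or with all weights equal to 1. *)
Definition path_strength (u : V) (p : seq V) : R :=
  \big[Num.min/1]_(w <- pairmap (mu G) u p) w.

(* All strengths are positive; the value is 0 when no path joins u to v. *)
Definition CONN (u v : V) : R :=
  \big[Num.max/0]_(p : #|V|.-bseq V | is_path u v p) path_strength u p.

Definition strong_edge (u v : V) : bool := is_edge u v && (mu G u v == CONN u v).

Definition strong_nbrs (u : V) : {set V} := [set v | strong_edge u v].

(* The index 1 is again an upper bound of the weights. *)
Definition mu_s (u : V) : R :=
  if strong_nbrs u == set0 then 0
  else \big[Num.min/1]_(v in strong_nbrs u) mu G u v.

Definition is_SNRDF (f : {ffun V -> 'I_3}) : bool :=
  [forall u, (f u == 0 :> nat) ==>
             [exists v in strong_nbrs u, f v == 2 :> nat]].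

Definition weight (f : {ffun V -> 'I_3}) : R := \sum_u (f u)%:R * mu_s u.

(* The constant function 2 is vacuously an SNRDF, as [arg min] requires of its
   starting point. *)
Definition gamma_snR : R :=
  weight [arg min_(f < [ffun => ord_max : 'I_3] | is_SNRDF f) weight f]%O.

End FuzzyGraph.

(* Main.v *)
(* Every u-v path has strength at most min(sigma u, sigma v), so every edge of
   a complete bipartite fuzzy graph is strong and the strong neighbors of a
   vertex form the opposite class. The value m = mu_s x_1 is the least value of
   mu_s on all of V and is also mu_s y_1. Hence the weight of f is at least m
   times the sum of f. If an SNRDF vanishes at a vertex u of some class, then the
   opposite class either carries a 2 facing another 2, or has no zero and a 2:
   this bounds the sum of f from below. The upper bounds come from assigning 2
   to x_1 and y_1, or 2 to one vertex of a class and 1 to the rest of it. In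
   (ii) the minimum of mu_s x_2 and mu_s y_2 is always m, as mu_s is constant on
   one of the classes. *)
Require Import Defs.
From HB Require Import structures.
From mathcomp Require Import all_boot all_order all_algebra.
From mathcomp Require Import reals.
From mathcomp Require Import zify lra.

Set Implicit Arguments.
Unset Strict Implicit.
Unset Printing Implicit Defensive.

Import Order.TTheory GRing.Theory Num.Theory.
Local Open Scope ring_scope.

Section CompleteBipartite.
Context (R : realType) (V : finType) (G : fuzzyGraph R V).
Implicit Types (u v : V) (X Y : {set V}) (p : seq V) (f : {ffun V -> 'I_3}).

(** * Path strength and connectedness *)

Lemma path_strength_cons u v p :
  path_strength G u (v :: p) = Num.min (mu G u v) (path_strength G v p).
Proof. by rewrite /path_strength /= big_cons. Qed.

(** Nonemptiness excludes the path with no edge, whose strength 1 may exceed [sigma]. *)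
Lemma path_strength_le_sigma_head u p :
  p != [::] -> path_strength G u p <= sigma G u.
Proof.
case: p => // v p _; rewrite path_strength_cons ge_min.
by have := mu_le G u v; rewrite le_min => /andP[-> _].
Qed.

Lemma path_strength_le_sigma_last u p :
  p != [::] -> path_strength G u p <= sigma G (last u p).
Proof.
elim: p u => // v [|w p] IHp u _; rewrite path_strength_cons ge_min /=.
  by have := mu_le G u v; rewrite le_min => /andP[_ ->].
by rewrite [X in _ || X](IHp v) ?orbT.
Qed.

(** As [u] and [v] differ, a path joining them has a first and a last edge, and these bound its
    strength. *)
Lemma CONN_le_sigma u v :
  u != v -> CONN G u v <= Num.min (sigma G u) (sigma G v).
Proof.
move=> neq_uv; have [/andP[su _] /andP[sv _]] := (sigma_itv G u, sigma_itv G v).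
apply: bigmax_le => [|p /and3P[_ /eqP last_p _]]; first by rewrite le_min su.
have p_neq0 : bseqval p != [::].
  by apply: contra neq_uv => /eqP p0; rewrite -last_p p0.
rewrite le_min path_strength_le_sigma_head //=.
by rewrite -[in X in _ <= X]last_p path_strength_le_sigma_last.
Qed.

Lemma mu_le_CONN u v : is_edge G u v -> mu G u v <= CONN G u v.
Proof.
move=> /andP[neq_uv mu_gt0].
have size_p : (size [:: v] <= #|V|)%N by apply/card_gt0P; exists u.
have -> : mu G u v = path_strength G u (Bseq size_p).
  have /andP[_ mu_le1] := mu_itv G u v.
  by rewrite path_strength_cons /path_strength big_nil min_l.
by apply: le_bigmax_cond; rewrite /is_path /= mu_gt0 eqxx inE neq_uv.
Qed.

(** * Strong neighbors and SNRDFs in complete bipartite fuzzy graphs *)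

Lemma complete_bipartiteC X Y :
  complete_bipartite G X Y -> complete_bipartite G Y X.
Proof.
case=> XY dXY X0 Y0 iX iY XYm; split=> //; first by rewrite setUC.
  by rewrite disjoint_sym.
by move=> u v uY vX; rewrite mu_sym XYm // minC.
Qed.

Hypothesis sigma_gt0 : forall v, 0 < sigma G v.

(** Between the classes [mu] attains the upper bound of [CONN_le_sigma]; positive memberships make
    such pairs edges. *)
Lemma strong_nbrs_bipartite X Y u :
  complete_bipartite G X Y -> u \in X -> strong_nbrs G u = Y.
Proof.
move=> hG uX; apply/setP=> v; rewrite inE.
have [vY|vY] := boolP (v \in Y).
  have neq_uv : u != v.
    apply: contraTneq vY => <-.
    by rewrite (disjointFr (cb_disjoint hG) uX).
  have uv_edge : is_edge G u v.
    by rewrite /is_edge neq_uv (cb_complete hG) // lt_min !sigma_gt0.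
  rewrite /strong_edge uv_edge eq_le mu_le_CONN //=.
  by rewrite (cb_complete hG) // CONN_le_sigma.
have vX : v \in X.
  by have := in_setT v; rewrite -(cb_cover hG) inE (negbTE vY) orbF.
by rewrite /strong_edge /is_edge (cb_X_indep hG) // ltxx andbF.
Qed.

Lemma mu_s_le_mu X Y u v :
  complete_bipartite G X Y -> u \in X -> v \in Y -> mu_s G u <= mu G u v.
Proof.
move=> hG uX vY; rewrite /mu_s (strong_nbrs_bipartite hG) //.
by rewrite (negbTE (cb_Y_neq0 hG)) bigmin_le_cond.
Qed.

Lemma mu_s_attained X Y u :
  complete_bipartite G X Y -> u \in X ->
  exists2 v, v \in Y & mu_s G u = mu G u v.
Proof.
move=> hG uX; rewrite /mu_s (strong_nbrs_bipartite hG) //.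
have /set0Pn[w wY] := cb_Y_neq0 hG.
(* The default 1 bounds all weights, so the minimum over the nonempty [Y] is taken at an actual
   vertex. *)
rewrite (negbTE (cb_Y_neq0 hG)) (bigmin_eq_arg _ w) //; first by case: arg_minP => // v vY _; exists v.
by move=> v _; have /andP[] := mu_itv G u v.
Qed.

Lemma is_SNRDF_bipartite X Y f : complete_bipartite G X Y ->
  reflect
    ((forall u, u \in X -> f u = 0%N :> nat -> exists2 v, v \in Y & f v = 2%N :> nat) /\
     (forall u, u \in Y -> f u = 0%N :> nat -> exists2 v, v \in X & f v = 2%N :> nat))
    (is_SNRDF G f).
Proof.
move=> hG; have hG' := complete_bipartiteC hG.
apply: (iffP forallP) => [fS|[fX fY] u].
  split=> u uX fu0; have := fS u; rewrite fu0 eqxx => /exists_inP[v].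
    by rewrite (strong_nbrs_bipartite hG uX) => vY /eqP; exists v.
  by rewrite (strong_nbrs_bipartite hG' uX) => vY /eqP; exists v.
apply/implyP=> /eqP fu0; apply/exists_inP.
have := in_setT u; rewrite -(cb_cover hG) inE => /orP[uX|uY].
  rewrite (strong_nbrs_bipartite hG uX).
  by have [v vY /eqP] := fX u uX fu0; exists v.
rewrite (strong_nbrs_bipartite hG' uY).
by have [v vX /eqP] := fY u uY fu0; exists v.
Qed.

(** * The minimum weight and its upper bounds *)

Lemma gamma_snR_attained : exists2 f, is_SNRDF G f & gamma_snR G = weight G f.
Proof.
rewrite /gamma_snR; case: arg_minP => [|f fS _]; last by exists f.
by apply/forallP=> u; rewrite ffunE.
Qed.

Lemma gamma_snR_le f : is_SNRDF G f -> gamma_snR G <= weight G f.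
Proof.
rewrite /gamma_snR; case: arg_minP => [|g _ gmin fS]; last exact: gmin.
by apply/forallP=> u; rewrite ffunE.
Qed.

Lemma bipartite_sum_split (T : nmodType) X Y (F : V -> T) :
  complete_bipartite G X Y ->
  \sum_u F u = \sum_(u in X) F u + \sum_(u in Y) F u.
Proof.
move=> hG; rewrite -bigU /=; last exact: cb_disjoint hG.
by apply: eq_bigl => u; have := in_setT u; rewrite -(cb_cover hG) !inE => ->.
Qed.

Lemma gamma_snR_le_edge X Y a b :
  complete_bipartite G X Y -> a \in X -> b \in Y ->
  gamma_snR G <= 2 * mu_s G a + 2 * mu_s G b.
Proof.
move=> hG aX bY.
pose f := [ffun v => if v \in [set a; b] then ord_max else ord0 : 'I_3].
have neq_ab : a != b.
  by apply: contraTneq bY => <-; rewrite (disjointFr (cb_disjoint hG) aX).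
have -> : 2 * mu_s G a + 2 * mu_s G b = weight G f.
  rewrite /weight (bigID (mem [set a; b])) /= [X in _ = _ + X]big1 ?addr0.
    under eq_bigr => u uab do rewrite ffunE uab.
    by rewrite big_setU1 ?inE ?(negbTE neq_ab) //= big_set1.
  by move=> u uab; rewrite ffunE (negbTE uab) mul0r.
apply/gamma_snR_le/(is_SNRDF_bipartite _ hG).
by split=> u _ _; [exists b | exists a]; rewrite // ffunE !inE eqxx ?orbT.
Qed.

Lemma gamma_snR_le_class X Y a :
  complete_bipartite G X Y -> a \in X ->
  gamma_snR G <= mu_s G a + \sum_(u in X) mu_s G u.
Proof.
move=> hG aX.
(* Value 2 at [a], 1 on the rest of [X], 0 on [Y]; the two indicators yield the two summands of the
   bound. *)
pose f := [ffun v => inord ((v == a) + (v \in X))%N : 'I_3].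
have fE v : f v = ((v == a) + (v \in X))%N :> nat.
  by rewrite ffunE inordK //; case: eqP; case: (v \in X).
have -> : mu_s G a + \sum_(u in X) mu_s G u = weight G f.
  rewrite /weight [in RHS](eq_bigr
    (fun u => (if u == a then mu_s G u else 0)
              + (if u \in X then mu_s G u else 0))).
    by rewrite big_split -!big_mkcond big_pred1_eq.
  move=> u _; rewrite fE natrD mulrDl.
  by case: eqP; case: (u \in X); rewrite ?mul1r ?mul0r.
apply/gamma_snR_le/(is_SNRDF_bipartite _ hG); split=> u uX.
  by rewrite fE uX addn1.
by exists a; rewrite // fE eqxx aX.
Qed.

(** * Lower bounds on the sum of values and on the weight *)

(* Either the opposite class carries a 2 as well, which gives total 4, or no
   vertex of Y may vanish, one of them having value 2. *)
Lemma SNRDF_sum_ge_of_zero X Y f u :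
  complete_bipartite G X Y -> is_SNRDF G f -> u \in X -> f u = 0%N :> nat ->
  (minn 4 #|Y|.+1 <= \sum_v f v)%N.
Proof.
move=> hG /(is_SNRDF_bipartite _ hG)[fX fY] uX fu0.
have [v vY fv2] := fX u uX fu0.
have -> : (\sum_v f v = \sum_(v in X) f v + \sum_(v in Y) f v)%N.
  exact: bipartite_sum_split hG.
have -> : (\sum_(y in Y) f y = 2 + \sum_(y in Y | y != v) f y)%N.
  by rewrite (bigD1 v vY) fv2.
rewrite geq_min.
have [/exists_inP[y yY /eqP fy0]|] := boolP [exists y in Y, f y == 0%N :> nat].
  by have [x xX fx2] := fY y yY fy0; rewrite (bigD1 x xX) /= fx2; lia.
rewrite negb_exists_in => /forall_inP fY0; apply/orP; right.
have : (\sum_(y in Y | y != v) 1 <= \sum_(y in Y | y != v) f y)%N.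
  by apply: leq_sum => y /andP[yY _]; rewrite lt0n fY0.
have : (1 + \sum_(y in Y | y != v) 1 = #|Y|)%N.
  by rewrite -sum1_card (bigD1 v vY).
lia.
Qed.

(** A zero in either class reduces to the previous bound, weakened by [#|X| <= #|Y|] if it lies in
    [X]; with no zero the sum is at least [#|X| + #|Y|]. *)
Lemma SNRDF_sum_ge X Y f :
  complete_bipartite G X Y -> is_SNRDF G f -> (#|X| <= #|Y|)%N ->
  (minn 4 #|X|.+1 <= \sum_v f v)%N.
Proof.
move=> hG fS leXY; have hG' := complete_bipartiteC hG.
have [/existsP[u /eqP fu0]|] := boolP [exists u, f u == 0%N :> nat].
  have := in_setT u; rewrite -(cb_cover hG) inE => /orP[uX|uY].
    have := SNRDF_sum_ge_of_zero hG fS uX fu0; lia.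
  exact: SNRDF_sum_ge_of_zero hG' fS uY fu0.
rewrite negb_exists => /forallP f0.
have : (\sum_(v : V) 1 <= \sum_v f v)%N.
  by apply: leq_sum => v _; rewrite lt0n.
have -> : (\sum_(v : V) 1 = \sum_(v in X) 1 + \sum_(v in Y) 1)%N.
  exact: bipartite_sum_split hG.
have : (0 < #|Y|)%N by rewrite card_gt0 (cb_Y_neq0 hG).
rewrite !sum1_card; lia.
Qed.

(** One unit at [v] is charged at [mu_s G v], all other units at the lower bound [m]. This serves
    (iii), with x_2 for [v]. *)
Lemma weight_ge f m v : (forall u, m <= mu_s G u) -> (0 < f v)%N ->
  mu_s G v + m * ((\sum_u f u)%N%:R - 1) <= weight G f.
Proof.
move=> m_le fv_gt0; rewrite /weight (bigD1 v) //= [X in _ <= X](bigD1 v) //=.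
have : m * (\sum_(u | u != v) f u)%N%:R <= \sum_(u | u != v) (f u)%:R * mu_s G u.
  rewrite natr_sum mulr_sumr; apply: ler_sum => u _.
  by rewrite mulrC ler_wpM2l.
have : m * ((f v)%:R - 1) <= mu_s G v * ((f v)%:R - 1).
  by rewrite ler_wpM2r // subr_ge0 ler1n.
rewrite natrD; lra.
Qed.

Lemma weight_ge_sum f m :
  (forall u, m <= mu_s G u) -> (\sum_u f u)%N%:R * m <= weight G f.
Proof.
move=> m_le; rewrite natr_sum mulr_suml.
by apply: ler_sum => u _; rewrite ler_wpM2l.
Qed.

Lemma gamma_snR_ge X Y m k :
  complete_bipartite G X Y -> (#|X| <= #|Y|)%N ->
  0 <= m -> (forall u, m <= mu_s G u) -> (k <= minn 4 #|X|.+1)%N ->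
  k%:R * m <= gamma_snR G.
Proof.
move=> hG leXY m_ge0 m_le lek; have [f fS ->] := gamma_snR_attained.
apply: le_trans (weight_ge_sum f m_le).
by rewrite ler_wpM2r // ler_nat (leq_trans lek) // (SNRDF_sum_ge hG).
Qed.

(* With x an endpoint of an edge of weight [mu_s G x], whichever endpoint has
   the smaller membership bounds [mu_s] on the whole opposite class. *)
Lemma mu_s_class_le X Y x :
  complete_bipartite G X Y -> x \in X ->
  {in X, forall u, mu_s G u <= mu_s G x} \/ {in Y, forall v, mu_s G v <= mu_s G x}.
Proof.
move=> hG xX; have hG' := complete_bipartiteC hG.
have [y yY ->] := mu_s_attained hG xX; rewrite (cb_complete hG) //.
have [_|_] := leP (sigma G x) (sigma G y).
  right=> v vY; apply: le_trans (mu_s_le_mu hG' vY xX) _.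
  by rewrite (cb_complete hG') // ge_min lexx orbT.
left=> u uX; apply: le_trans (mu_s_le_mu hG uX yY) _.
by rewrite (cb_complete hG) // ge_min lexx orbT.
Qed.

End CompleteBipartite.

(** * Classes enumerated from index 1 *)

Lemma set_ord_succ_mem (T : finType) (X : {set T}) n (x : nat -> T) i :
  X = [set x (nat_of_ord j).+1 | j : 'I_n] -> (i < n)%N -> x i.+1 \in X.
Proof. by move=> -> ltin; apply/imsetP; exists (Ordinal ltin). Qed.

Lemma sum_set_ord_succ (R : nmodType) (T : finType) (X : {set T}) n
    (x : nat -> T) (F : T -> R) :
  X = [set x (nat_of_ord j).+1 | j : 'I_n] -> #|X| = n ->
  \sum_(u in X) F u = \sum_(i < n) F (x i.+1).
Proof.
move=> -> cardX; rewrite big_imset //=.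
(* There are as many images as indices, so the enumeration is injective. *)
by apply/imset_injP; rewrite cardX card_ord.
Qed.

Lemma mono_head_le (R : numDomainType) (T : finType) (X : {set T}) n
    (x : nat -> T) (F : T -> R) :
  X = [set x (nat_of_ord j).+1 | j : 'I_n] ->
  (forall i, (1 <= i < n)%N -> F (x i) <= F (x i.+1)) ->
  {in X, forall u, F (x 1%N) <= F u}.
Proof.
move=> -> x_mono _ /imsetP[[i ltin] _ ->] /=.
elim: i ltin => // i IHi ltin.
by apply: le_trans (IHi (ltnW ltin)) _; apply: x_mono.
Qed.

Theorem proposition3p9 (R : realType) (V : finType) (G : fuzzyGraph R V)
    (X Y : {set V}) (r s : nat) (x y : nat -> V)
    (hG : complete_bipartite G X Y)
    (sigma_gt0 : forall v : V, 0 < sigma G v)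
    (hX : X = [set x (nat_of_ord i).+1 | i : 'I_r])
    (hY : Y = [set y (nat_of_ord j).+1 | j : 'I_s])
    (cardX : #|X| = r) (cardY : #|Y| = s)
    (le_rs : (r <= s)%N)
    (x_mono : forall i : nat, (1 <= i < r)%N -> mu_s G (x i) <= mu_s G (x i.+1))
    (y_mono : forall j : nat, (1 <= j < s)%N -> mu_s G (y j) <= mu_s G (y j.+1)) :
  [/\ (* (i) *)
      r = 1%N -> gamma_snR G = 2 * mu_s G (x 1%N),
      (* (ii) *)
      r = 2%N -> s = 2%N ->
        (2 * mu_s G (x 1%N) <= Num.min (mu_s G (x 2%N)) (mu_s G (y 2%N)) ->
           gamma_snR G = 4 * mu_s G (x 1%N)) /\
        (Num.max (mu_s G (x 2%N)) (mu_s G (y 2%N)) <= 2 * mu_s G (x 1%N) ->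
           gamma_snR G = 2 * mu_s G (x 1%N)
                         + Num.min (mu_s G (x 2%N)) (mu_s G (y 2%N))),
      (* (iii) *)
      r = 2%N -> (3 <= s)%N ->
        gamma_snR G = Num.min (4 * mu_s G (x 1%N))
                              (2 * mu_s G (x 1%N) + mu_s G (x 2%N))
    & (* (iv) *)
      (3 <= r)%N -> gamma_snR G = 4 * mu_s G (x 1%N)].
Proof.
have hG' := complete_bipartiteC hG; set m := mu_s G (x 1%N).
have s_gt0 : (0 < s)%N by rewrite -cardY card_gt0 (cb_Y_neq0 hG).
have r_gt0 : (0 < r)%N by rewrite -cardX card_gt0 (cb_X_neq0 hG).
have x1X : x 1%N \in X by exact: set_ord_succ_mem hX _.
have y1Y : y 1%N \in Y by exact: set_ord_succ_mem hY _.
have le_mX : {in X, forall u, m <= mu_s G u} := mono_head_le hX x_mono.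
have le_mY : {in Y, forall v, m <= mu_s G v}.
  (* [mu_s G v] is the weight of an edge to some [u] in [X], hence at least [mu_s G u]. *)
  move=> v vY; have [u uX ->] := mu_s_attained sigma_gt0 hG' vY.
  apply: le_trans (le_mX u uX) _.
  by rewrite mu_sym (mu_s_le_mu sigma_gt0 hG).
have le_m u : m <= mu_s G u.
  by have := in_setT u; rewrite -(cb_cover hG) inE => /orP[/le_mX|/le_mY].
have m_ge0 : 0 <= m.
  rewrite /m; have [v _ ->] := mu_s_attained sigma_gt0 hG x1X.
  by have /andP[] := mu_itv G (x 1%N) v.
have y1E : mu_s G (y 1%N) = m.
  apply/eqP; rewrite eq_le le_m andbT /m.
  (* An edge of weight [m] at x_1 ends at some [v] in [Y], so [mu_s] is at most [m] at [v], and thus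
     at y_1. *)
  have [v vY ->] := mu_s_attained sigma_gt0 hG x1X.
  apply: le_trans (mono_head_le hY y_mono vY) _.
  by rewrite mu_sym (mu_s_le_mu sigma_gt0 hG').
have gamma_ge k : (k <= minn 4 r.+1)%N -> k%:R * m <= gamma_snR G.
  by rewrite -cardX; apply: (gamma_snR_ge sigma_gt0 hG); rewrite ?cardX ?cardY.
have gamma_le4 : gamma_snR G <= 4 * m.
  have := gamma_snR_le_edge sigma_gt0 hG x1X y1Y; rewrite y1E -/m; lra.
have gamma_leX := gamma_snR_le_class sigma_gt0 hG x1X.
rewrite (sum_set_ord_succ _ hX cardX) -/m in gamma_leX.
have gamma_leY := gamma_snR_le_class sigma_gt0 hG' y1Y.
rewrite (sum_set_ord_succ _ hY cardY) y1E in gamma_leY.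
split=> [r1|r2 s2|r2 s3|r3].
- apply/eqP; rewrite eq_le gamma_ge ?r1 // andbT.
  move: gamma_leX; rewrite r1 big_ord1 -/m; lra.
- have x2X : x 2%N \in X by apply: set_ord_succ_mem hX _; rewrite r2.
  have y2Y : y 2%N \in Y by apply: set_ord_succ_mem hY _; rewrite s2.
  have min_eq : Num.min (mu_s G (x 2%N)) (mu_s G (y 2%N)) = m.
    apply/eqP; rewrite eq_le le_min !le_m !andbT ge_min.
    apply/orP; have [le_x|le_y] := mu_s_class_le sigma_gt0 hG x1X.
      by left; exact: le_x x2X.
    by right; exact: le_y y2Y.
  have gamma_eq : gamma_snR G = 3 * m.
    apply/eqP; rewrite eq_le gamma_ge ?r2 // andbT.
    (* Whichever of x_2 and y_2 has the smaller [mu_s] has it equal to [m]; values 2 and 1 on its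
       class cost [3 * m]. *)
    move: gamma_leX gamma_leY min_eq; rewrite r2 s2 !big_ord_recl !big_ord0.
    by rewrite /= /bump /= -/m y1E; case: (leP (mu_s G (x 2%N))) => _; lra.
  (* In the first case [2 * m <= m] forces [m = 0], where [3 * m] and [4 * m] agree. *)
  rewrite min_eq gamma_eq; lra.
- have x2X : x 2%N \in X by apply: set_ord_succ_mem hX _; rewrite r2.
  apply/eqP; rewrite eq_le le_min gamma_le4 /=; apply/andP; split.
    move: gamma_leX; rewrite r2 !big_ord_recl big_ord0 /= /bump /= -/m; lra.
  have [f fS ->] := gamma_snR_attained G; rewrite ge_min.
  have [fx2|fx2_gt0] := posnP (f (x 2%N)).
    (* Since [3 <= s], a zero at x_2 forces the values to sum to at least 4. *)
    have := SNRDF_sum_ge_of_zero sigma_gt0 hG fS x2X fx2.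
    rewrite cardY => sum_ge; rewrite (le_trans _ (weight_ge_sum f le_m)) //.
    by rewrite ler_wpM2r // ler_nat; lia.
  (* The sum is at least 3: one unit sits at x_2, and at least two more cost [m] or more each. *)
  have := SNRDF_sum_ge sigma_gt0 hG fS; rewrite cardX cardY r2 => sum_ge.
  rewrite orbC (le_trans _ (weight_ge le_m fx2_gt0)) // addrC lerD2l.
  have : 3%:R * m <= (\sum_u f u)%N%:R * m.
    by rewrite ler_wpM2r // ler_nat; lia.
  lra.
- apply/eqP; rewrite eq_le gamma_le4 gamma_ge //; lia.
Qed.
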